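(* Let $(X,d)$ be a finite metric space with $X=\{x_1,\ldots,x_n\}$ (the $x_i$ distinct) and let $\mu$ be the uniform probability measure on $X$. Let $f:X\to\mathbb{R}^m$ be a function which realizes $d_{\mathrm{srGW},2}(X,\mathbb{R}^m)$, i.e. $\mathrm{dis}_2(\mu_f)=d_{\mathrm{srGW},2}(X,\mathbb{R}^m)$, where $\mathbb{R}^m$ carries the Euclidean distance. Then the point cloud $f(x_1),\ldots,f(x_n)\in\mathbb{R}^m$ is a solution of the metric multidimensional scaling problem, i.e. $(f(x_1),\dots,f(x_n))$ minimizes $$(y_1,\ldots,y_n)\mapsto\sum_{i,j=1}^n\big(d(x_i,x_j)-\|y_i-y_j\|\big)^2$$ over all $(y_1,\ldots,y_n)\in(\mathbb{R}^m)^n$.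
   Context: For a metric measure space $(X,d_X,\mu_X)$ (complete separable metric space with a Borel probability measure) and a complete separable metric space $(Y,d_Y)$, a semi-coupling of $\mu_X$ and $Y$ is a Borel probability measure $\gamma$ on $X\times Y$ with first marginal $\mu_X$; the set of these is $\mathcal{SC}(\mu_X,Y)$. The $2$-distortion of $\gamma$ is $$\mathrm{dis}_2(\gamma)=\frac12\left(\iint |d_X(x,x')-d_Y(y,y')|^2\,d\gamma(x,y)\,d\gamma(x',y')\right)^{1/2},$$ and $d_{\mathrm{srGW},2}(X,Y)=\inf_{\gamma\in\mathcal{SC}(\mu_X,Y)}\mathrm{dis}_2(\gamma)$. For a measurable $f:X\to Y$, the induced semi-coupling is $\mu_f=(\mathrm{id}_X\times f)_\#\mu_X$, where $(\mathrm{id}_X\times f)(x)=(x,f(x))$; for finite $X$, $\mu_f=\sum_{x\in X}\mu_X(\{x\})\,\delta_{(x,f(x))}$. *)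

(* Defs.v *)
From HB Require Import structures.
From mathcomp Require Import all_boot all_order all_algebra.
From mathcomp Require Import all_classical all_reals all_analysis.
From mathcomp Require Import ring lra.

Set Implicit Arguments.
Unset Strict Implicit.
Unset Printing Implicit Defensive.

Import Order.TTheory GRing.Theory Num.Theory.

Local Open Scope classical_set_scope.
Local Open Scope ring_scope.

(* The distinguished point is required by [measurableType]; it only excludes
   the empty space, which carries no probability measure. *)
#[short(type="pmetricType")]
HB.structure Definition PMetric (K : numDomainType) :=
  { M of Metric K M & Pointed M }.

(* The Borel sigma-algebra. For a product this is the sigma-algebra generated
   by the open sets of the product topology. *)
Notation borel T := (g_sigma_algebraType (@open T%type)).

Section euclidean_space.
Variables (R : realType) (m : nat).

(* An alias of ['rV[R]_m], because the library equips ['rV[R]_m] with the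
   distance of the sup norm. *)
Definition euclidean : Type := 'rV[R]_m.

HB.instance Definition _ := GRing.Zmodule.on euclidean.
HB.instance Definition _ := isPointed.Build euclidean 0.

Definition enorm (v : euclidean) : R := Num.sqrt (\sum_(k < m) v 0 k ^+ 2).

Let sumsq_ge0 (v : euclidean) : 0 <= \sum_(k < m) v 0 k ^+ 2.
Proof. by apply: sumr_ge0 => k _; exact: sqr_ge0. Qed.

Lemma enorm_ge0 v : 0 <= enorm v.
Proof. exact: sqrtr_ge0. Qed.

Lemma sqr_enorm v : enorm v ^+ 2 = \sum_(k < m) v 0 k ^+ 2.
Proof. exact: sqr_sqrtr. Qed.

Lemma enorm0 : enorm 0 = 0.
Proof.
by rewrite /enorm big1 ?sqrtr0// => k _; rewrite mxE expr0n.
Qed.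

Lemma enorm_eq0 v : enorm v = 0 -> v = 0.
Proof.
move=> v0; apply/rowP => k; rewrite mxE; apply/eqP.
have /eqP := sqr_enorm v; rewrite v0 expr0n/= eq_sym psumr_eq0; last first.
  by move=> i _; exact: sqr_ge0.
by move=> /allP/(_ k (mem_index_enum k)); rewrite /= sqrf_eq0.
Qed.

Lemma enormN v : enorm (- v) = enorm v.
Proof. by congr Num.sqrt; apply: eq_bigr => k _; rewrite mxE sqrrN. Qed.

Lemma enorm_cauchy (u v : euclidean) :
  \sum_(k < m) u 0 k * v 0 k <= enorm u * enorm v.
Proof.
set C := \sum_(k < m) _.
apply: (le_trans (ler_norm C)).
rewrite -ler_sqr ?nnegrE ?mulr_ge0 ?enorm_ge0//.
rewrite real_normK ?num_real// exprMn !sqr_enorm.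
have : 0 <= \sum_(i < m) \sum_(j < m) (u 0 i * v 0 j - u 0 j * v 0 i) ^+ 2.
  by apply: sumr_ge0 => i _; apply: sumr_ge0 => j _; exact: sqr_ge0.
under eq_bigr do under eq_bigr do rewrite sqrrB !exprMn.
under eq_bigr do rewrite !big_split/= sumrN -mulr_sumr -mulr_suml.
rewrite !big_split/= sumrN -mulr_suml -mulr_sumr.
suff -> : \sum_(i < m) \sum_(j < m) u 0 i * v 0 j * (u 0 j * v 0 i) *+ 2
    = C ^+ 2 *+ 2 by move=> ?; lra.
rewrite expr2 mulr_suml -sumrMnl; apply: eq_bigr => i _.
rewrite mulr_sumr -sumrMnl; apply: eq_bigr => j _.
by congr (_ *+ 2); ring.
Qed.

Lemma enormD (u v : euclidean) : enorm (u + v) <= enorm u + enorm v.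
Proof.
rewrite -ler_sqr ?nnegrE ?addr_ge0 ?enorm_ge0// sqrrD !sqr_enorm.
under eq_bigr do rewrite mxE sqrrD.
rewrite !big_split/= lerD2r lerD2l -mulr2n lerMn2r.
exact: enorm_cauchy.
Qed.

Let edist (u v : euclidean) := enorm (u - v).

Let edistxx u : edist u u = 0.
Proof. by rewrite /edist subrr enorm0. Qed.

Let edist_positivity u v : edist u v = 0 -> u = v.
Proof. by move=> /enorm_eq0/eqP; rewrite subr_eq0 => /eqP. Qed.

Let edist_sym u v : edist u v = edist v u.
Proof. by rewrite /edist -opprB enormN. Qed.

Let edist_triangle v u w : edist u w <= edist u v + edist v w.
Proof. by rewrite /edist -[u - w](subrKA v) enormD. Qed.

HB.instance Definition _ := @isMetric.Build R euclidean edist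
  edistxx edist_positivity edist_sym edist_triangle.

Lemma mdist_euclideanE (u v : euclidean) : mdist u v = enorm (u - v).
Proof. by []. Qed.

End euclidean_space.

(* Meant for complete separable X and Y; the definitions make sense without
   these properties, which hold for finite X and for Y Euclidean. *)
Section srGW.
Context {R : realType} {X Y : pmetricType R}.
Local Open Scope ereal_scope.

Definition semi_couplings (mu : probability (borel X) R) :
    set (probability (borel (X * Y)) R) :=
  [set gamma | forall A : set (borel X), measurable A ->
    pushforward gamma (fst : borel (X * Y) -> borel X) A = mu A].

(* Written as an iterated integral, which for this nonnegative integrand is the
   integral against the product of gamma with itself. The value is in [\bar R]
   because the integral may be infinite. *)
Definition dis2 (gamma : set (borel (X * Y)) -> \bar R) : \bar R :=
  (2^-1)%:E *
  (\int[gamma]_p \int[gamma]_q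
     ((`|mdist (p : X * Y).1 (q : X * Y).1
         - mdist (p : X * Y).2 (q : X * Y).2| ^+ 2)%R)%:E) `^ 2^-1.

Definition induced_semi_coupling (mu : probability (borel X) R) (f : X -> Y) :
    set (borel (X * Y)) -> \bar R :=
  pushforward mu ((fun x => (x, f x)) : borel X -> borel (X * Y)).

End srGW.

Definition d_srGW2 {R : realType} {X : pmetricType R}
    (mu : probability (borel X) R) (Y : pmetricType R) : \bar R :=
  ereal_inf [set dis2 gamma | gamma in @semi_couplings R X Y mu].

Definition mds_stress {R : realType} {X : metricType R} {n m : nat}
    (x : 'I_n -> X) (y : 'I_n -> euclidean R m) : R :=
  \sum_(i < n) \sum_(j < n) (mdist (x i) (x j) - enorm (y i - y j)) ^+ 2.

Definition mds_solution {R : realType} {X : metricType R} {n m : nat}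
    (x : 'I_n -> X) (y : 'I_n -> euclidean R m) : Prop :=
  forall y' : 'I_n -> euclidean R m, mds_stress x y <= mds_stress x y'.

(* Main.v *)
(* Every subset of a finite metric space is Borel, so for every h : X -> R^m the
   measure mu_h is a semi-coupling, and its distortion is a finite double sum:
   dis_2(mu_h) = sqrt(stress(h) / n^2) / 2. Every configuration (y_1, ..., y_n)
   has the form (h(x_1), ..., h(x_n)), so d_srGW <= dis_2(mu_h), with equality
   for f, is the minimality of the stress of f. *)
Require Import Defs.
From HB Require Import structures.
From mathcomp Require Import all_boot all_order all_algebra.
From mathcomp Require Import all_classical all_reals all_analysis.
From mathcomp Require Import measurable_realfun.

Set Implicit Arguments.
Unset Strict Implicit.
Unset Printing Implicit Defensive.

Import Order.TTheory GRing.Theory Num.Theory.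
Import numFieldTopology.Exports numFieldNormedType.Exports.

Local Open Scope classical_set_scope.
Local Open Scope ring_scope.

(** By the reverse triangle inequality, [mdist a] is 1-Lipschitz. *)
Lemma mdist_continuousr (R : realType) (T : metricType R) (a : T) :
  continuous (mdist a : T -> R).
Proof.
move=> b; apply/cvgrPdist_lt => /= e e0.
near=> c.
have bc : mdist b c < e.
  by near: c; apply: (@metricType_numDomainType.cvgr_dist_lt R T T) => //;
    exact: cvg_id.
rewrite (le_lt_trans _ bc)// ler_norml lerBlDl lerNl opprB lerBlDl.
by rewrite (metric_sym b c) metric_triangle (metric_sym c b) metric_triangle.
Unshelve. all: by end_near. Qed.

(** Makes the product a [ptopologicalType], so that [continuous_borel_measurable] applies on
    [X * Y]. *)
HB.instance Definition _ (T U : ptopologicalType) :=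
  Pointed.copy (T * U)%type (T * U)%type.

Lemma continuous_borel_measurable (R : realType) (T : ptopologicalType)
    (g : T -> R) :
  continuous g -> measurable_fun [set: borel T] (g : borel T -> R).
Proof.
move=> /continuousP cg; apply: (measurability _ (RGenOpens.measurableE R)).
move=> _ [_ [a [b ->] <-]]; rewrite setTI.
by apply: sub_sigma_algebra; exact/cg/interval_open.
Qed.

(** Singletons are closed in a T1 space, and here every subset is a finite union of them. *)
Lemma finite_borel_measurable (T : ptopologicalType) (A : set (borel T)) :
  accessible_space T -> finite_set [set: T] -> measurable A.
Proof.
move=> accT finT.
have -> : A = \bigcup_(a in A) [set a] by rewrite bigcup_imset1 image_id.
apply: fin_bigcup_measurable; first exact: sub_finite_set finT.
move=> a _; rewrite -[X in measurable X]setCK.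
apply: measurableC; apply: sub_sigma_algebra; rewrite openC.
exact: accessible_closed_set1.
Qed.

Section uniform_measure.
Context {R : realType} {X : pmetricType R} {n : nat} {x : 'I_n -> X}.
Hypotheses (x_inj : injective x) (x_surj : range x = [set: X]).

Lemma range_borel_measurable (A : set (borel X)) : measurable A.
Proof.
apply: finite_borel_measurable.
- exact/hausdorff_accessible/metric_hausdorff.
- by rewrite -x_surj; apply: finite_image; exact: finite_finset.
Qed.

Lemma range_measurable_fun d (Z : measurableType d) (D : set (borel X))
    (h : borel X -> Z) : measurable_fun D h.
Proof. by move=> _ B _; exact: range_borel_measurable. Qed.

Variable (mu : probability (borel X) R).
Hypothesis mu_unif : forall i : 'I_n, mu [set x i] = (n%:R^-1)%:E.

(** The space splits into the atoms [[set x i]], pairwise disjoint by [x_inj], and [g] is constant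
    on each. *)
Lemma integral_uniform (g : X -> R) :
  (forall a, 0 <= g a) ->
  (\int[mu]_a (g a)%:E = (n%:R^-1 * \sum_i g (x i))%:E)%E.
Proof.
move=> g0.
have mX := range_borel_measurable.
have xT : [set: borel X] = \big[setU/set0]_(i <- index_enum 'I_n) [set x i].
  rewrite -x_surj eqEsubset; split => [_ [i _ <-]|//].
    by rewrite -bigcup_seq; exists i => //=; rewrite mem_index_enum.
  by rewrite x_surj.
rewrite [in LHS]xT ge0_integral_bigsetU//=; last 3 first.
- exact: index_enum_uniq.
- by move=> i j _ _ [a [/= -> /x_inj]].
- by move=> a _; rewrite lee_fin.
rewrite mulr_sumr -sumEFin; apply: eq_bigr => i _.
rewrite (eq_integral (cst (g (x i))%:E)); last by move=> a /[!inE]/= ->.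
by rewrite integral_cst// [X in (_ * X)%E]mu_unif -EFinM mulrC.
Qed.

Section induced.
Context {Y : pmetricType R}.
Variable f : X -> Y.

Lemma integral_induced (g : X * Y -> R) :
  measurable_fun [set: borel (X * Y)] (g : borel (X * Y) -> R) ->
  (forall p, 0 <= g p) ->
  (\int[induced_semi_coupling mu f]_p (g p)%:E
   = (n%:R^-1 * \sum_i g (x i, f (x i)))%:E)%E.
Proof.
move=> mg g0.
rewrite ge0_integral_pushforward//=; last 3 first.
- exact: range_measurable_fun.
- exact/measurable_EFinP.
- by move=> p _; rewrite lee_fin.
by rewrite preimage_setT (integral_uniform (g := fun a => g (a, f a))).
Qed.

(** For fixed [p], both distances are continuous in [q] for the product topology, hence Borel. *)
Lemma distortion_measurable (p : X * Y) :
  measurable_fun [set: borel (X * Y)]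
    ((fun q : X * Y => `|mdist p.1 q.1 - mdist p.2 q.2| ^+ 2) :
       borel (X * Y) -> R).
Proof.
apply: measurable_funX.
apply: (@measurableT_comp _ _ _ _ _ _ (fun r : R => `|r|)) => //.
apply: measurable_funB;
  apply: (@continuous_borel_measurable R (X * Y)%type) => q.
- apply: (@continuous_comp _ _ _ fst (mdist p.1)); first exact: cvg_fst.
  exact: mdist_continuousr.
- apply: (@continuous_comp _ _ _ snd (mdist p.2)); first exact: cvg_snd.
  exact: mdist_continuousr.
Qed.

Lemma dis2_induced :
  dis2 (induced_semi_coupling mu f) =
  (2^-1 * Num.sqrt (n%:R^-1 * \sum_i (n%:R^-1 * \sum_j
     `|mdist (x i) (x j) - mdist (f (x i)) (f (x j))| ^+ 2)))%:E.
Proof.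
rewrite /dis2.
rewrite (_ : (fun p => _) = fun p : X * Y => (n%:R^-1 * \sum_j
    `|mdist p.1 (x j) - mdist p.2 (f (x j))| ^+ 2)%:E); last first.
  apply/funext => p.
  by rewrite (integral_induced (@distortion_measurable p))// => q;
    exact: sqr_ge0.
rewrite (integral_induced (g := fun p => n%:R^-1 * \sum_j
   `|mdist p.1 (x j) - mdist p.2 (f (x j))| ^+ 2)); last 2 first.
- apply: measurable_funM => //; apply: measurable_sum => j.
  (* Here [p] varies: by symmetry of both distances it becomes the second argument, and
     [(x j, f (x j))] is the fixed point. *)
  under eq_fun => p do rewrite (metric_sym p.1) (metric_sym p.2).
  exact: (distortion_measurable (x j, f (x j))).
- by move=> p; rewrite mulr_ge0 ?invr_ge0 ?ler0n ?sumr_ge0// => j _;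
    exact: sqr_ge0.
rewrite -/(_ `^ _)%E poweR_EFin powR12_sqrt ?EFinM//.
by rewrite mulr_ge0 ?invr_ge0 ?ler0n ?sumr_ge0// => i _;
  rewrite mulr_ge0 ?invr_ge0 ?ler0n ?sumr_ge0// => j _; exact: sqr_ge0.
Qed.

(** The first coordinate of [a |-> (a, f a)] is the identity, so its law has first marginal [mu] and
    competes in the infimum. *)
Lemma d_srGW2_le_induced :
  (d_srGW2 mu Y <= dis2 (induced_semi_coupling mu f))%E.
Proof.
pose h : borel X -> borel (X * Y) := fun a => (a, f a).
have mh : measurable_fun [set: borel X] h by exact: range_measurable_fun.
(* [semi_couplings] contains bundled probabilities; [distribution mu hp] is the pushforward in
   bundled form. *)
pose hM := isMeasurableFun.Build _ _ _ _ h mh.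
pose hp : {mfun borel X >-> borel (X * Y)} := HB.pack h hM.
by apply: ereal_inf_lbound; exists (distribution mu hp).
Qed.

End induced.

End uniform_measure.

Theorem corollary6 (R : realType) (X : pmetricType R) (n m : nat)
  (x : 'I_n -> X) (x_inj : injective x) (x_surj : range x = [set: X])
  (mu : probability (borel X) R)
  (mu_unif : forall i : 'I_n, mu [set x i] = (n%:R^-1)%:E)
  (f : X -> euclidean R m)
  (f_real : dis2 (induced_semi_coupling mu f) = d_srGW2 mu (euclidean R m)) :
  mds_solution x (fun i => f (x i)).
Proof.
move=> y'.
(* Transports [y'] to [X] through the inverse of [x]; the default 0 is never taken, since [x] is
   onto. *)
pose f' (a : X) : euclidean R m := oapp y' 0 [pick i | x i == a].
have f'x i : f' (x i) = y' i.
  by rewrite /f'; case: pickP => [j /eqP/x_inj ->//|/(_ i)]; rewrite eqxx.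
have stressE (h : X -> euclidean R m) :
    \sum_i (n%:R^-1 * \sum_j
      `|mdist (x i) (x j) - mdist (h (x i)) (h (x j))| ^+ 2)
    = n%:R^-1 * mds_stress x (h \o x).
  rewrite -mulr_sumr; congr (_ * _).
  apply: eq_bigr => i _; apply: eq_bigr => j _.
  by rewrite real_normK ?num_real.
have := d_srGW2_le_induced x_surj mu f'.
rewrite -f_real !(dis2_induced x_inj x_surj mu_unif) !stressE lee_fin.
have -> : mds_stress x (f' \o x) = mds_stress x y'.
  by apply: eq_bigr => i _; apply: eq_bigr => j _ /=; rewrite !f'x.
have stress_ge0 : 0 <= mds_stress x y'.
  by apply: sumr_ge0 => i _; apply: sumr_ge0 => j _; exact: sqr_ge0.
(* The distinguished point yields an index, so [n] is positive and the factors [n%:R^-1] can be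
   cancelled. *)
have [i _ _] : range x point by rewrite x_surj.
have n1 : 0 < n%:R^-1 :> R by rewrite invr_gt0 ltr0n (leq_trans _ (ltn_ord i)).
(* Cancels the factor 1/2, then the square root by monotonicity; the last line removes both factors
   [n%:R^-1]. *)
rewrite ler_pM2l ?invr_gt0// ler_sqrt ?mulr_ge0 ?(ltW n1)//.
by rewrite !ler_pM2l.
Qed.
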